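(* Let $r=\sqrt[3]{1/4}$, $$\alpha_1=\frac{3\sqrt3\,r}{2-3r},\qquad \alpha_2=-\frac{\sqrt3\left[(3r+2)^2+4\right]}{2(3r-2)^2},$$ and for $a\in[0,1]$ set $\zeta(a)=\exp\left[i\left(\frac{\pi}{3}+\alpha_1a+\alpha_2a^2\right)\right]$ and $$p_a(z)=(z-a)(z+1)\left[z-\zeta(a)\right]\left[z-\overline{\zeta(a)}\right]\in S_4.$$ Then for all sufficiently small $a>0$ one has $\Delta(p_a,z^4+z)=\mathcal{O}(a)$ and $$d(p_a)=|p_a|_a=r+Ca^2+\mathcal{O}(a^3),\qquad\text{where } C=\frac{3}{4r(2-3r)}\approx 10.81154938$$ (the $\mathcal{O}$-terms being understood as $a\to 0^+$). In particular, the polynomial $z^4+z$ is not locally maximal for Sendov's conjecture.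
   Context: $S_n$ is the set of monic complex polynomials of degree $n\ge2$ having all their zeros in the closed unit disk. $Z(f)$ denotes the zero set of $f$. For $p\in S_n$ and $\alpha\in\mathbf{C}$, $|p|_\alpha=\min_{w\in Z(p')}|\alpha-w|$ and $d(p)=\max_{z\in Z(p)}\min_{w\in Z(p')}|z-w|$. For monic polynomials $p(z)=\prod_{i=1}^n(z-z_i)$ and $q(z)=\prod_{i=1}^n(z-\zeta_i)$ of the same degree $n$, $\Delta(p,q)=\min_{\sigma\in\Sigma_n}\max_{1\le i\le n}|z_i-\zeta_{\sigma(i)}|$, where $\Sigma_n$ is the symmetric group on $n$ elements. A polynomial $p\in S_n$ is called locally maximal for Sendov's conjecture if there exists $\varepsilon>0$ such that $d(q)\le d(p)$ for every $q\in S_n$ with $\Delta(q,p)<\varepsilon$. *)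

(* Defs.v *)
From HB Require Import structures.
From mathcomp Require Import all_boot all_order all_fingroup all_algebra.
From mathcomp Require Import all_classical all_reals all_analysis.
From mathcomp Require Import complex.

Set Implicit Arguments.
Unset Strict Implicit.
Unset Printing Implicit Defensive.
Import Order.TTheory GRing.Theory Num.Theory numFieldNormedType.Exports.

Local Open Scope classical_set_scope.
Local Open Scope ring_scope.

(* The norm on [R[i]] takes its values in [R[i]]; this one is real-valued. *)
Definition cabs (R : realType) (z : R[i]) : R := Normc.normc z.

Definition zeros (R : realType) (f : {poly R[i]}) : set R[i] :=
  [set z | root f z].

Definition unit_disk_polys (R : realType) (n : nat) : set {poly R[i]} :=
  [set p | [/\ p \is monic, size p = n.+1 &
             forall z, zeros p z -> cabs z <= 1]].

(* |p|_alpha. When deg p >= 2 the sets below are finite and nonempty, so that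
   [inf] is a minimum and, in [sendov_d], [sup] is a maximum. *)
Definition crit_dist (R : realType) (p : {poly R[i]}) (alpha : R[i]) : R :=
  inf [set cabs (alpha - w) | w in zeros p^`()].

Definition sendov_d (R : realType) (p : {poly R[i]}) : R :=
  sup [set crit_dist p z | z in zeros p].

(* The zeros of [p], each repeated according to its multiplicity. *)
Definition root_seq (R : realType) (p : {poly R[i]}) : seq R[i] :=
  sval (closed_field_poly_normal p).

(* Minimum over the permutations; seeding it with the value at the identity
   and the inner maximum of nonnegative reals with 0 changes neither. *)
Definition matching_dist (R : realType) (n : nat) (s t : seq R[i]) : R :=
  let cost (sigma : 'S_n) :=
    \big[Num.max/0]_(i < n) cabs (s`_i - t`_(sigma i)) in
  \big[Num.min/cost 1%g]_(sigma : 'S_n) cost sigma.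

(* Meant for [size p = size q]; minimizing over all permutations makes the
   value independent of the orderings chosen by [root_seq]. *)
Definition Delta (R : realType) (p q : {poly R[i]}) : R :=
  matching_dist (size p).-1 (root_seq p) (root_seq q).

(* For [p] in [unit_disk_polys n]; that membership is not repeated here. *)
Definition locally_maximal (R : realType) (n : nat) (p : {poly R[i]}) : Prop :=
  exists2 eps : R, 0 < eps &
    forall q, unit_disk_polys n q -> Delta q p < eps ->
      sendov_d q <= sendov_d p.

Section Family.
Variable R : realType.

Definition cexp_i (t : R) : R[i] := (cos t +i* sin t)%C.

Definition r0 : R := (1 / 4) `^ (1 / 3).

Definition alpha1 : R := 3 * Num.sqrt 3 * r0 / (2 - 3 * r0).

Definition alpha2 : R :=
  - (Num.sqrt 3 * ((3 * r0 + 2) ^+ 2 + 4)) / (2 * (3 * r0 - 2) ^+ 2).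

Definition C0 : R := 3 / (4 * r0 * (2 - 3 * r0)).

Definition zeta (a : R) : R[i] :=
  cexp_i (pi / 3 + alpha1 * a + alpha2 * a ^+ 2).

Definition p_ (a : R) : {poly R[i]} :=
  ('X - (a%:C%C)%:P) * ('X + 1) * ('X - (zeta a)%:P) * ('X - ((zeta a)^*%C)%:P).

End Family.

Arguments r0 R : clear implicits.
Arguments alpha1 R : clear implicits.
Arguments alpha2 R : clear implicits.
Arguments C0 R : clear implicits.

(* Main.v *)
Require Import Defs.
From HB Require Import structures.
From mathcomp Require Import all_boot all_order all_fingroup all_algebra.
From mathcomp Require Import all_classical all_reals all_analysis.
From mathcomp Require Import complex.
From mathcomp Require Import ring lra.
Import Order.TTheory GRing.Theory Num.Theory numFieldNormedType.Exports.
Local Open Scope classical_set_scope.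
Local Open Scope ring_scope.
Set Implicit Arguments.
Unset Strict Implicit.
Unset Printing Implicit Defensive.

(* Put [z = a + v]. Then [p_a'(a + v)] is a real cubic [g] in [v] whose roots, at
   [a = 0], are [- r] and [r exp(+- i pi / 3)]; the moduli of its roots are the
   distances from [a] to the critical points. The coefficients depend on [a] and
   on [m = 1 - 2 cos(theta a) = m1 a + m2 a^2 + O(a^3)], and the choice of
   alpha1, alpha2 amounts to a choice of [m1], [m2] for which
   [g (- (r + C a^2)) = O(a^3)] and [g(0) = 4 (r + C a^2)^3 + O(a^3)]. The
   first gives by the intermediate value theorem a real root
   [- (r + C a^2) + O(a^3)]; by the second and Vieta the other two roots,
   which are conjugate, have the same modulus up to [O(a^3)]. The remaining
   zeros of [p_a] stay at distance about [1 - r < r] from a critical point, so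
   [d(p_a)] is attained at [a]. Finally [z^4 + z = p_0], and [C > 0]. *)

(** * Uniform bounds for remainder terms *)

Section BoundedOn.
Variables (F : realFieldType) (T : Type) (D : T -> Prop).

(** Stands in for O-notation: a remainder built from bounded quantities by ring operations is
    bounded uniformly on [D], and the tactic [bounded] reads this off its shape. *)
Definition bounded_on (f : T -> F) : Prop :=
  exists2 M, 0 <= M & forall t, D t -> `|f t| <= M.

Lemma bounded_on_cst c : bounded_on (fun=> c).
Proof. by exists `|c|. Qed.

Lemma bounded_on_le f M : (forall t, D t -> `|f t| <= M) -> bounded_on f.
Proof.
move=> fM; exists (Num.max 0 M); first by rewrite le_max lexx.
by move=> t /fM; rewrite le_max orbC => ->.
Qed.

Lemma bounded_onD f g :
  bounded_on f -> bounded_on g -> bounded_on (fun t => f t + g t).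
Proof.
move=> [M M0 fM] [N N0 gN]; exists (M + N); first exact: addr_ge0.
by move=> t Dt; rewrite (le_trans (ler_normD _ _))// lerD ?fM ?gN.
Qed.

Lemma bounded_onN f : bounded_on f -> bounded_on (fun t => - f t).
Proof. by move=> [M M0 fM]; exists M => // t /fM; rewrite normrN. Qed.

Lemma bounded_onM f g :
  bounded_on f -> bounded_on g -> bounded_on (fun t => f t * g t).
Proof.
move=> [M M0 fM] [N N0 gN]; exists (M * N); first exact: mulr_ge0.
by move=> t Dt; rewrite normrM ler_pM ?fM ?gN.
Qed.

Lemma bounded_onX f n : bounded_on f -> bounded_on (fun t => f t ^+ n).
Proof.
move=> bf; elim: n => [|n IH]; first exact: bounded_on_cst.
have [M M0 fM] := bounded_onM bf IH.
by exists M => // t Dt; rewrite exprS fM.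
Qed.

End BoundedOn.

Ltac bounded := repeat first
  [ assumption | exact: bounded_on_cst
  | apply: bounded_onD | apply: bounded_onN | apply: bounded_onX
  | apply: bounded_onM ].

(** * Roots of the shifted derivative, up to order three in [a] *)

Section Cubic.
Variable F : rcfType.
Implicit Types a m v : F.

(* The derivative of [(z - a) (z^3 + m z^2 + m z + 1)] at [z = a + v]; the
   cubic cofactor is [(z + 1) (z^2 - 2 c z + 1)] with [m = 1 - 2 c]. *)
Definition shifted_cubic a m v : F :=
  4 * v ^+ 3 + 3 * (3 * a + m) * v ^+ 2
  + 2 * (3 * a ^+ 2 + 2 * a * m + m) * v + (a ^+ 3 + m * a ^+ 2 + m * a + 1).

Lemma shifted_cubic_ivt a m v w : v <= w ->
  shifted_cubic a m v <= 0 <= shifted_cubic a m w ->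
  exists2 x, v <= x <= w & shifted_cubic a m x = 0.
Proof.
move=> vw; pose p : {poly F} := (4 : F)%:P * 'X ^+ 3
  + (3 * (3 * a + m))%:P * 'X ^+ 2
  + (2 * (3 * a ^+ 2 + 2 * a * m + m))%:P * 'X
  + (a ^+ 3 + m * a ^+ 2 + m * a + 1)%:P.
have pE x : p.[x] = shifted_cubic a m x by rewrite /p /shifted_cubic !hornerE.
rewrite -!pE => /(poly_ivt vw)[x xvw /rootP]; rewrite pE => x0.
by exists x.
Qed.

(** The remainder enters as a free parameter [rho], so that estimates uniform over [|rho| <= M] stay
    purely algebraic. *)
Definition mid_coef m1 m2 a rho : F := m1 * a + m2 * a ^+ 2 + rho * a ^+ 3.

Definition main_modulus r C a : F := r + C * a ^+ 2.

(* The middle equations say that [g (- main_modulus r C a) = O(a^3)], for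
   [g] the shifted cubic with [m = mid_coef m1 m2 a rho]; the last equation says
   that the product of the moduli of the roots of [g] is [main_modulus^3 + O(a^3)]. *)
Definition second_order_system r C m1 m2 : Prop :=
  [/\ 31 / 50 <= r <= 64 / 100, 4 * r ^+ 3 = 1,
      3 * (3 + m1) * r ^+ 2 = 2 * r * m1,
      3 * m2 * r ^+ 2 + m1 = 12 * r ^+ 2 * C + 2 * r * (3 + 2 * m1 + m2) &
      m1 = 12 * r ^+ 2 * C].

Definition small_pair (M : F) (t : F * F) : Prop := 0 <= t.1 <= 1 /\ `|t.2| <= M.

Lemma bounded_on_fst M : bounded_on (small_pair M) fst.
Proof.
by apply: (@bounded_on_le _ _ _ _ 1) => t [/andP[? ?] _]; rewrite ger0_norm.
Qed.

Lemma bounded_on_snd M : bounded_on (small_pair M) snd.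
Proof. by apply: (@bounded_on_le _ _ _ _ M) => t []. Qed.

(** In the expansion in powers of [a], the coefficients of 1, [a] and [a^2] vanish by [r3], [ord1]
    and [ord2] respectively. *)
Lemma shifted_cubic_main_term (r C m1 m2 M : F) :
  let m := mid_coef m1 m2 in let s := main_modulus r C in
  second_order_system r C m1 m2 ->
  exists2 N, 0 <= N & forall a rho, 0 <= a <= 1 -> `|rho| <= M ->
    `|shifted_cubic a (m a rho) (- s a)| <= N * a ^+ 3.
Proof.
move=> m s [_ r3 ord1 ord2 _].
have b1 := @bounded_on_fst M; have b2 := @bounded_on_snd M.
pose mu (t : F * F) := m1 + m2 * t.1 + t.2 * t.1 ^+ 2.
(* [E] is the quotient by [a^3] of all terms of order at least three. *)
pose E (t : F * F) := - (12 * r * C ^+ 2 * t.1) - 4 * C ^+ 3 * t.1 ^+ 3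
  + 3 * t.2 * r ^+ 2 + 3 * (3 + mu t) * (2 * r * C + C ^+ 2 * t.1 ^+ 2)
  - 2 * r * (2 * m2 + 2 * t.2 * t.1 + t.2)
  - 2 * C * (3 * t.1 + 2 * t.1 * mu t + mu t) + 1 + mu t + m2 + t.2 * t.1.
have bE : bounded_on (small_pair M) E.
  have bmu : bounded_on (small_pair M) mu by rewrite /mu; bounded.
  by rewrite /E; bounded.
have [N N0 EN] := bE; exists N => // a rho a01 rhoM.
have -> : shifted_cubic a (m a rho) (- s a) = E (a, rho) * a ^+ 3
   + ((1 - 4 * r ^+ 3) + (3 * (3 + m1) * r ^+ 2 - 2 * r * m1) * a
   + (3 * m2 * r ^+ 2 + m1
  - (12 * r ^+ 2 * C + 2 * r * (3 + 2 * m1 + m2))) * a ^+ 2).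
  by rewrite /shifted_cubic /E /mu /m /s /mid_coef /main_modulus /=; ring.
rewrite r3 ord1 ord2 !subrr !mul0r !addr0 normrM.
have /andP[a0 _] := a01.
by rewrite [`|a ^+ 3|]ger0_norm ?exprn_ge0// ler_wpM2r ?exprn_ge0// EN.
Qed.


(** The value at [- s a] is at most [N a^3] in modulus while the slope there is close to
    [12 r^2 > 4]; moving the argument by [(N + 1) a^3] either way therefore forces a sign change. *)
Lemma shifted_cubic_real_root (r C m1 m2 M : F) :
  let m := mid_coef m1 m2 in let s := main_modulus r C in
  second_order_system r C m1 m2 ->
  exists K a0, [/\ 0 <= K, 0 < a0 <= 1 &
  forall a rho, 0 < a <= a0 -> `|rho| <= M ->
    exists2 v, `|v + s a| <= K * a ^+ 3 & shifted_cubic a (m a rho) v = 0].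
Proof.
move=> m s sys; have [/andP[rge _] _ _ _ _] := sys.
have [N N0 gN] := shifted_cubic_main_term M sys.
pose D3 (t : F * F * F) := small_pair M t.1 /\ `|t.2| <= N + 1.
have b1 : bounded_on D3 (fun t => t.1.1).
  by have [B B0 Bf] := @bounded_on_fst M; exists B => // t [/Bf].
have b2 : bounded_on D3 (fun t => t.1.2).
  by have [B B0 Bf] := @bounded_on_snd M; exists B => // t [/Bf].
have b3 : bounded_on D3 snd.
  by apply: (@bounded_on_le _ _ _ _ (N + 1)) => t [].
pose mu (t : F * F * F) := m1 + m2 * t.1.1 + t.1.2 * t.1.1 ^+ 2.
pose S (t : F * F * F) := r + C * t.1.1 ^+ 2.
have bmu : bounded_on D3 mu by rewrite /mu; bounded.
have bS : bounded_on D3 S by rewrite /S; bounded.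
pose E (t : F * F * F) := 24 * r * C * t.1.1 + 12 * C ^+ 2 * t.1.1 ^+ 3
  - 6 * (3 + mu t) * S t + 2 * (3 * t.1.1 + 2 * t.1.1 * mu t + mu t)
  + t.2 * t.1.1 ^+ 2 * (9 * t.1.1 + 3 * t.1.1 * mu t - 12 * S t)
  + 4 * t.2 ^+ 2 * t.1.1 ^+ 5.
have [B B0 EB] : bounded_on D3 E by rewrite /E; bounded.
(* Expansion around [- s a] with increment [k a^3]; the points of [D3] are the triples
   [(a, rho, k)]. *)
have gE a rho k : shifted_cubic a (m a rho) (- s a + k * a ^+ 3) =
    shifted_cubic a (m a rho) (- s a)
    + a ^+ 3 * (k * (12 * r ^+ 2 + a * E (a, rho, k))).
  by rewrite /shifted_cubic /E /S /mu /m /s /mid_coef /main_modulus /=; ring.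
exists (N + 1), (1 + B)^-1; split; first by rewrite addr_ge0.
  by rewrite invr_gt0 invf_le1; lra.
move=> a rho /andP[a_gt0 a_le] rhoM.
have aB : a * (1 + B) <= 1 by rewrite -ler_pdivlMr ?div1r//; lra.
have a01 : 0 <= a <= 1 by rewrite ltW//=; nra.
have a3 : 0 < a ^+ 3 by rewrite exprn_gt0.
have Ek k : `|k| <= N + 1 -> `|a * E (a, rho, k)| <= 1.
  move=> kN; have D3t : D3 (a, rho, k) by [].
  have := EB _ D3t; rewrite normrM gtr0_norm// => EB'.
  apply: le_trans aB; rewrite ler_wpM2l ?(ltW a_gt0)//; lra.
(* Together with [Ek] this keeps the slope factor [12 r^2 + a E] at least 3. *)
have r2 : 4 <= 12 * r ^+ 2 by clear -rge; nra.
have := gN a rho a01 rhoM; set G := shifted_cubic _ _ _ => GN.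
have := Ek (N + 1); have := Ek (- (N + 1)).
rewrite normrN ger0_norm ?addr_ge0// => /(_ (lexx _)) E1 /(_ (lexx _)) E2.
have [||v /andP[v1 v2] v0] := @shifted_cubic_ivt a (m a rho)
    (- s a + - (N + 1) * a ^+ 3) (- s a + (N + 1) * a ^+ 3).
- by rewrite lerD2l ler_pM2r//; lra.
- rewrite !gE -/G; move: GN E1 E2; rewrite !ler_norml.
  set e1 := _ * E _; set e2 := _ * E _.
  set x := 12 * _ in r2 *.
  set A := a ^+ 3 in a3 *.
  move=> /andP[G1 G2] /andP[? ?] /andP[? ?].
  have k1 : N * A <= A * ((N + 1) * (x + e1)) by rewrite mulrC ler_pM2l//; nra.
  have k2 : N * A <= A * ((N + 1) * (x + e2)) by rewrite mulrC ler_pM2l//; nra.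
  by clear -G1 G2 k1 k2; apply/andP; split; lra.
- exists v => //; rewrite ler_norml.
  by clear -v1 v2; apply/andP; split; lra.
Qed.


(* The factorization is [4 (v - v1) (v^2 + (b / 4) v + e / 4)]; the quadratic
   factor has negative discriminant, so [Num.sqrt (e / 4)] is the modulus of
   its roots. *)
Lemma shifted_cubic_factor (r C m1 m2 M : F) :
  let m := mid_coef m1 m2 in let s := main_modulus r C in
  second_order_system r C m1 m2 ->  exists K a0, [/\ 0 <= K, 0 < a0 <= 1 &
  forall a rho, 0 < a <= a0 -> `|rho| <= M -> exists v1 b e,
    [/\ [/\ 3 * (3 * a + m a rho) = b - 4 * v1,
         2 * (3 * a ^+ 2 + 2 * a * m a rho + m a rho) = e - v1 * b &
         a ^+ 3 + m a rho * a ^+ 2 + m a rho * a + 1 = - v1 * e],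
     `|v1 + s a| <= K * a ^+ 3,
     `|Num.sqrt (e / 4) - s a| <= K * a ^+ 3 &
     [/\ a <= 1 / 1000, `|m a rho| <= 1 / 1000, `|s a - r| <= 1 / 1000,
       K * a ^+ 3 <= 1 / 1000 & 0 <= e]]].
Proof.
move=> m s sys; have [/andP[r_ge r_le] r3 _ _ Cm1] := sys.
pose c2 a rho := 3 * (3 * a + m a rho).
pose c1 a rho := 2 * (3 * a ^+ 2 + 2 * a * m a rho + m a rho).
pose c0 a rho := a ^+ 3 + m a rho * a ^+ 2 + m a rho * a + 1.
have [K1 [a1 [K10 /andP[a1_gt0 a1_le] root1]]] := shifted_cubic_real_root M sys.
have b1 := @bounded_on_fst M; have b2 := @bounded_on_snd M.
pose mu (t : F * F) := m1 + m2 * t.1 + t.2 * t.1 ^+ 2.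
have bmu : bounded_on (small_pair M) mu by rewrite /mu; bounded.
have [Mu Mu0 muP] := bmu.
pose E (t : F * F) := m2 + t.2 * t.1 + mu t + 1 - 12 * r * C ^+ 2 * t.1
  - 4 * C ^+ 3 * t.1 ^+ 3.
have [N N0 EN] : bounded_on (small_pair M) E by rewrite /E; bounded.
pose K := N + 4 * K1.
have K0 : 0 <= K by rewrite /K; lra.
have K1K : K1 <= K by rewrite /K; lra.
(* Each summand serves one smallness condition: [a <= 1 / B] makes [a], [K a], [|C| a], [Mu a] and
   [a / a1] all at most 1/1000. *)
pose B := 1000 * (1 + K + `|C| + Mu + a1^-1).
have a1V : 0 < a1^-1 by rewrite invr_gt0.
have CP : 0 <= `|C| by [].
have B_ge1 : 1 <= B by rewrite /B; clear -K0 CP Mu0 a1V; lra.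
have B_gt0 : 0 < B by rewrite (lt_le_trans ltr01).
have BE : 1000 * (1 + K + `|C| + Mu + a1^-1) = B by [].
clearbody B; exists K, B^-1; split => //; first by rewrite invr_gt0 B_gt0 invf_le1.
move=> a rho /andP[a_gt0 a_le] rhoM.
have aBE x : 0 <= x -> x <= 1 + K + `|C| + Mu + a1^-1 -> x * a <= 1 / 1000.
  move: (_ + a1^-1) BE => X BE x0 xX; have : a * (1000 * x) <= 1.
    rewrite -[leRHS](mulVf (lt0r_neq0 B_gt0)).
    apply: (ler_pM (ltW a_gt0) (mulr_ge0 (ler0n _ _) x0) a_le).
    by rewrite -BE; clear -xX; lra.
  by clear; lra.
have a_small : a <= 1 / 1000.
  by rewrite -[a]mul1r aBE//; clear -K0 CP Mu0 a1V; lra.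
have a_le1 : a <= 1 by clear -a_small; lra.
have a01 : 0 <= a <= 1 by rewrite ltW.
have aa1 : a <= a1.
  have : a1^-1 * a <= 1 / 1000 by rewrite aBE ?(ltW a1V)//; clear -K0 CP Mu0; lra.
  by move=> h; rewrite -(ler_pM2l a1V) mulVf ?gt_eqF//; clear -h; lra.
have a2a : a ^+ 2 <= a by rewrite expr2 -[leRHS]mulr1 ler_wpM2l// ltW.
have a3a : a ^+ 3 <= a by rewrite exprSr -[leRHS]mul1r ler_wpM2r ?(ltW a_gt0)//; clear -a2a a_le1; lra.
have Dt : small_pair M (a, rho) by [].
have a3 : 0 < a ^+ 3 by rewrite exprn_gt0.
have m_small : `|m a rho| <= 1 / 1000.
  rewrite (_ : m a rho = mu (a, rho) * a); last by rewrite /m /mid_coef /mu /=; ring.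
  rewrite normrM (gtr0_norm a_gt0) (le_trans (ler_wpM2r (ltW a_gt0) (muP _ Dt)))//.
  by rewrite aBE//; clear -K0 CP a1V; lra.
have s_small : `|s a - r| <= 1 / 1000.
  rewrite /s /main_modulus addrC addKr normrM (ger0_norm (sqr_ge0 _)).
  by rewrite (le_trans (ler_wpM2l CP a2a))// aBE//; clear -K0 Mu0 a1V; lra.
have K_small : K * a ^+ 3 <= 1 / 1000.
  by rewrite (le_trans (ler_wpM2l K0 a3a))// aBE//; clear -CP Mu0 a1V; lra.
have [v v_near v_root] : exists2 v, `|v + s a| <= K1 * a ^+ 3
    & shifted_cubic a (m a rho) v = 0 by apply: root1; rewrite // a_gt0.
have v_near' : `|v + s a| <= K * a ^+ 3.
  by rewrite (le_trans v_near)// ler_wpM2r// ltW.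
have v_ltr : 3 / 5 <= - v.
  move: v_near' s_small K_small r_ge; clear.
  by rewrite !ler_norml => /andP[? ?] /andP[? ?]; lra.
(* Synthetic division by the linear factor of the root [v]. *)
pose b := 4 * v + c2 a rho; pose e := v * b + c1 a rho.
have c0E : c0 a rho = - v * e.
  move: v_root; rewrite /shifted_cubic -/(c2 a rho) -/(c1 a rho) -/(c0 a rho).
  by move=> h; apply/eqP; rewrite -subr_eq0 -h /e /b; apply/eqP; ring.
(* [c0] is close to 1; as [c0 = - v e] with [- v > 0], this gives [e > 0], so that the square root
   below is genuine. *)
have c0_gt0 : 0 < c0 a rho.
  rewrite /c0; move: (m a rho) m_small => mm; rewrite ler_norml => /andP[mm1 _].
  have h1 : - a ^+ 2 <= mm * a ^+ 2.
    by rewrite -mulN1r ler_wpM2r ?sqr_ge0//; clear -mm1; lra.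
  have h2 : - a <= mm * a.
    by rewrite -mulN1r ler_wpM2r ?(ltW a_gt0)//; clear -mm1; lra.
  by clear -h1 h2 a2a a3 a_small; lra.
have e_gt0 : 0 < e by rewrite -(pmulr_rgt0 _ (_ : 0 < - v)) -?c0E//; clear -v_ltr; lra.
exists v, b, e; split=> //; last by split=> //; exact: ltW.
  by split => //; rewrite /e /b /c1 /c2; ring.
have s_ge : 3 / 5 <= s a.
  by move: s_small r_ge; clear; rewrite ler_norml => /andP[? ?]; lra.
have s_le : s a <= 1.
  by move: s_small r_le; clear; rewrite ler_norml => /andP[? ?]; lra.
set w := Num.sqrt (e / 4).
have w0 : 0 <= w by exact: sqrtr_ge0.
have w2 : w ^+ 2 = e / 4 by rewrite sqr_sqrtr// divr_ge0 ?(ltW e_gt0).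
clearbody w e.
have key : (w - s a) * (4 * - v * (w + s a))
    = E (a, rho) * a ^+ 3 + 4 * s a ^+ 2 * (v + s a).
  have -> : (w - s a) * (4 * - v * (w + s a))
      = c0 a rho - 4 * - v * s a ^+ 2.
    have eE : e = 4 * w ^+ 2 by rewrite w2; field.
    by rewrite c0E eE; ring.
  have /subr0_eq <- : c0 a rho - 4 * - v * s a ^+ 2
    - (E (a, rho) * a ^+ 3 + 4 * s a ^+ 2 * (v + s a)) = 0; last by [].
  have -> : c0 a rho - 4 * - v * s a ^+ 2
    - (E (a, rho) * a ^+ 3 + 4 * s a ^+ 2 * (v + s a))
    = (1 - 4 * r ^+ 3) + (m1 - 12 * r ^+ 2 * C) * a ^+ 2.
    by rewrite /c0 /E /mu /m /s /mid_coef /main_modulus /=; ring.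
  by rewrite r3 -Cm1 !subrr mul0r addr0.
have P1 : 1 <= 4 * - v * (w + s a).
  by clear -v_ltr s_ge w0; nra.
have P0 : 0 <= 4 * - v * (w + s a) by rewrite (le_trans ler01).
have : `|w - s a| * (4 * - v * (w + s a)) <= K * a ^+ 3.
  rewrite -[X in _ * X <= _](ger0_norm P0).
  rewrite -normrM key (le_trans (ler_normD _ _))// [in leRHS]/K [leRHS]mulrDl lerD//.
    rewrite normrM [`|a ^+ 3|]gtr0_norm// ler_wpM2r ?(ltW a3)//.
    exact: EN.
  rewrite -[leRHS]mulrA !normrM [`|4|]ger0_norm// -mulrA ler_wpM2l//.
  have s_abs : `|s a| <= 1 by rewrite ger0_norm// (le_trans _ s_ge)// divr_ge0.
  by rewrite -[leRHS]mul1r ler_pM ?mulr_ge0// mulr_ile1.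
by apply: le_trans; rewrite -[leLHS]mulr1 ler_wpM2l.
Qed.

End Cubic.

(** * Taylor bounds for sine and cosine, and their values at pi/3 *)

Section Trigonometry.
Variable R : realType.
Implicit Types x y : R.

(** Mean value theorem. Bounding [f'] only on a symmetric interval containing [x] and [y] lets [c]
    depend on them, as in [sin_taylor]. *)
Lemma lipschitz_of_derive (f f' : R -> R) (c x y : R) :
  (forall t : R, is_derive t 1 f (f' t)) ->
  (forall t, `|t| <= Num.max `|x| `|y| -> `|f' t| <= c) ->
  `|f x - f y| <= c * `|x - y|.
Proof.
move=> fd f'c; wlog xy : x y f'c / y <= x.
  move=> h; have [yx|/ltW xy] := leP y x; first exact: h.
  by rewrite distrC [`|x - y|]distrC h// => t; rewrite maxC; exact: f'c.
move: xy; rewrite le_eqVlt => /predU1P[->|yx]; first by rewrite !subrr normr0 mulr0.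
have [t|t tyx ->] := MVT yx (fun t _ => fd t).
  apply: derivable_within_continuous => z _.
  exact: (@ex_derive _ _ _ _ _ _ _ (fd z)).
rewrite normrM ler_wpM2r// f'c//.
move: tyx; rewrite in_itv/= => /andP[/ltW yt /ltW tx].
rewrite le_max; have [t0|t0] := leP 0 t.
  by rewrite ger0_norm// (le_trans tx (ler_norm x)).
by rewrite ltr0_norm// orbC -(normrN y) (le_trans _ (ler_norm _))// lerN2.
Qed.

Lemma sin_lipschitz x y : `|sin x - sin y| <= `|x - y|.
Proof.
rewrite -[leRHS]mul1r; apply: (lipschitz_of_derive (f' := cos)) => t _.
by rewrite ler_norml cos_geN1 cos_le1.
Qed.

Lemma cos_lipschitz x y : `|cos x - cos y| <= `|x - y|.
Proof.
rewrite -[leRHS]mul1r; apply: (lipschitz_of_derive (f' := fun t => - sin t)) => t _.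
by rewrite normrN ler_norml sin_geN1 sin_le1.
Qed.

Lemma sin_le_norm x : `|sin x| <= `|x|.
Proof. by have := sin_lipschitz x 0; rewrite sin0 !subr0. Qed.

Lemma cosB1 x : cos x - 1 = - 2 * sin (x / 2) ^+ 2.
Proof.
rewrite [in LHS](_ : x = x / 2 + x / 2); last by field.
by rewrite cosD -[X in _ - X = _](cos2Dsin2 (x / 2)); ring.
Qed.

(** The derivative of [sin t - t] is [- 2 sin(t/2)^2], at most [x^2] in modulus between 0 and
    [x]. *)
Lemma sin_taylor x : `|sin x - x| <= `|x| ^+ 3.
Proof.
have := @lipschitz_of_derive (fun t => sin t - t) (fun t => cos t - 1)
  (`|x| ^+ 2) x 0.
rewrite sin0 !subr0 -exprSr; apply => t.
rewrite normr0 (max_idPl _)// => tx.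
rewrite cosB1 normrM normrX.
have : `|sin (t / 2)| ^+ 2 <= (`|t| / 2) ^+ 2.
  rewrite ler_pXn2r ?nnegrE ?divr_ge0// (le_trans (sin_le_norm _))//.
  by rewrite normrM [`|2^-1|]ger0_norm.
have : `|t| ^+ 2 <= `|x| ^+ 2 by rewrite ler_pXn2r ?nnegrE.
by rewrite normrN [`|2|]ger0_norm// expr_div_n; have := sqr_ge0 `|t|; lra.
Qed.

(** With [y = x / 2] the left side factors as [- 2 (sin y - y) (sin y + y)]: a cubic bound times a
    linear one. *)
Lemma cos_taylor x : `|cos x - 1 + x ^+ 2 / 2| <= `|x| ^+ 4.
Proof.
have -> : cos x - 1 + x ^+ 2 / 2 = - 2 * ((sin (x / 2) - x / 2) * (sin (x / 2) + x / 2)).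
  by rewrite cosB1; field.
set y := x / 2.
have y2 : `|sin y + y| <= 2 * `|y|.
  by rewrite (le_trans (ler_normD _ _))//; have := sin_le_norm y; lra.
rewrite normrM normrN normrM [`|2|]ger0_norm//.
have := ler_pM (normr_ge0 _) (normr_ge0 _) (sin_taylor y) y2.
have -> : `|x| = 2 * `|y| by rewrite /y normrM [`|2^-1|]ger0_norm//; field.
rewrite exprMn; have := exprn_ge0 4 (normr_ge0 y).
rewrite mulrCA -exprSr; lra.
Qed.

Lemma pi3_lt_pihalf : 0 < (pi / 3 : R) < pi / 2.
Proof. by have := pi_gt0 R; move=> h; apply/andP; split; lra. Qed.

(** Tripling the angle gives [4 c^3 - 3 c = - 1], that is [(c + 1) (2 c - 1)^2 = 0], and [c > 0]. *)
Lemma cos_pi3 : cos (pi / 3) = 1 / 2 :> R.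
Proof.
have /andP[p0 p1] := pi3_lt_pihalf.
have c0 : 0 < cos (pi / 3) :> R.
  by rewrite cos_gt0_pihalf// p1 (lt_trans _ p0)// oppr_lt0 (lt_trans p0).
have : cos (pi / 3 + pi / 3 + pi / 3) = - 1 :> R.
  by rewrite -(cospi R); congr cos; field.
rewrite !(cosD, sinD); have := cos2Dsin2 (pi / 3 : R).
move: (cos _) c0 (sin _) => c c0 s cs h.
have : (c + 1) * (2 * c - 1) ^+ 2 = 0.
  have s2 : s ^+ 2 = 1 - c ^+ 2 by rewrite -cs addrAC subrr add0r.
  have -> : (c + 1) * (2 * c - 1) ^+ 2 = (c * c - s * s) * c
      - (s * c + c * s) * s + 1 + 3 * c * (s ^+ 2 - (1 - c ^+ 2)) by ring.
  by rewrite h s2 subrr mulr0 addr0 addNr.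
move/eqP; rewrite mulf_eq0 sqrf_eq0 gt_eqF/=; last by lra.
by move=> /eqP hc; lra.
Qed.

Lemma sin_pi3 : sin (pi / 3) = Num.sqrt 3 / 2 :> R.
Proof.
have /andP[p0 p1] := pi3_lt_pihalf.
have s0 : 0 <= sin (pi / 3) :> R.
  by rewrite sin_ge0_pi// ltW//= (le_trans (ltW p1))//; have := pi_ge0 R; lra.
rewrite -[LHS](ger0_norm s0) -sqrtr_sqr.
rewrite sin2cos2 cos_pi3 (_ : 1 - _ = 3 / 2 ^+ 2); last by field.
by rewrite sqrtrM// sqrtrV// sqrtr_sqr ger0_norm.
Qed.

End Trigonometry.

(** * The constants [r], [alpha1], [alpha2] and [C] *)

Lemma cube_bounds (F : realFieldType) (x lo hi : F) :
  0 <= x -> 0 <= lo -> 0 <= hi -> 4 * lo ^+ 3 <= 1 -> 1 <= 4 * hi ^+ 3 ->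
  4 * x ^+ 3 = 1 -> lo <= x <= hi.
Proof.
move=> x0 lo0 hi0 lo1 hi1 x1.
by rewrite -[lo <= x](@ler_pXn2r _ 3)// -[x <= hi](@ler_pXn2r _ 3)//; lra.
Qed.

Section Constants.
Variable R : realType.

Notation r := (r0 R).
Notation C := (C0 R).

Lemma r0_gt0 : 0 < r. Proof. by rewrite powR_gt0// divr_gt0. Qed.

Lemma r0_cube : 4 * r ^+ 3 = 1.
Proof.
rewrite -powR_mulrn ?(ltW r0_gt0)// /r0 -powRrM (_ : 1 / 3 * 3%:R = 1); last by field.
by rewrite powRr1; [field|lra].
Qed.

(** The precision is for [C0_approx]: [2 - 3 r] is only about 0.11, so an error in [r] is magnified
    a few hundred times in [C]. *)
Lemma r0_bounds :
  629 / 10 ^+ 3 + 960 / 10 ^+ 6 + 524 / 10 ^+ 9 + 94 / 10 ^+ 11 <= r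
    <= 629 / 10 ^+ 3 + 960 / 10 ^+ 6 + 524 / 10 ^+ 9 + 95 / 10 ^+ 11.
Proof. by apply: cube_bounds (ltW r0_gt0) _ _ _ _ r0_cube; lra. Qed.

Lemma r0_rough : 31 / 50 <= r <= 64 / 100.
Proof. by have /andP[? ?] := r0_bounds; apply/andP; split; lra. Qed.

Lemma r0_lt : 0 < 2 - 3 * r.
Proof. by have /andP[_ ?] := r0_rough; lra. Qed.

(** [mu1] and [mu2] are the Taylor coefficients of [mid]: one has [1 - 2 cos(pi/3 + d) = sqrt 3 d +
    d^2 / 2 + O(d^3)], with [d = alpha1 a + alpha2 a^2]. *)
Definition mu1 : R := Num.sqrt 3 * alpha1 R.
Definition mu2 : R := Num.sqrt 3 * alpha2 R + alpha1 R ^+ 2 / 2.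

Lemma mu1E : mu1 = 9 * r / (2 - 3 * r).
Proof.
rewrite /mu1 /alpha1; have := @sqr_sqrtr R 3 (ler0n _ _).
move: (Num.sqrt _) => q q2; have r0 := gt_eqF r0_lt.
have -> : q * (3 * q * r / (2 - 3 * r)) = 3 * q ^+ 2 * r / (2 - 3 * r).
  by field; rewrite r0.
by rewrite q2; field; rewrite r0.
Qed.

Lemma mu2E : mu2 = - (12 + 18 * r) / (2 - 3 * r) ^+ 2.
Proof.
rewrite /mu2 /alpha1 /alpha2; have := @sqr_sqrtr R 3 (ler0n _ _).
move: (Num.sqrt _) => q q2; have r0 := gt_eqF r0_lt.
have r1 : 3 * r - 2 == 0 = false by rewrite lt_eqF//; have := r0_lt; lra.
have -> : q * (- (q * ((3 * r + 2) ^+ 2 + 4)) / (2 * (3 * r - 2) ^+ 2))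
   + (3 * q * r / (2 - 3 * r)) ^+ 2 / 2
  = q ^+ 2 * (9 * r ^+ 2 - ((3 * r + 2) ^+ 2 + 4)) / (2 * (2 - 3 * r) ^+ 2).
  by field; rewrite r0 r1.
by rewrite q2; field; rewrite r0.
Qed.

(** The first-order equation determines [m1 = 9 r / (2 - 3 r)], the last one then gives
    [C = m1 / (12 r^2)], and the other one is linear in [m2]. *)
Lemma second_order_system_r0 : second_order_system r C mu1 mu2.
Proof.
have r0 := gt_eqF r0_lt; have r1 := gt_eqF r0_gt0.
have m1C : mu1 = 12 * r ^+ 2 * C.
  by rewrite mu1E /C0; field; rewrite r0 r1.
split=> //; first exact: r0_rough.
- exact: r0_cube.
- by rewrite mu1E; field; rewrite r0.
- by rewrite -m1C mu2E mu1E; field; rewrite r0.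
Qed.

Lemma C0_gt0 : 0 < C.
Proof. by rewrite /C0 divr_gt0// mulr_gt0 ?r0_lt// mulr_gt0 ?r0_gt0. Qed.

Lemma C0_approx :
  `|C - (10 + 811 / 10 ^+ 3 + 549 / 10 ^+ 6 + 38 / 10 ^+ 8)| < 1 / 10 ^+ 7.
Proof.
have D_gt0 : 0 < 4 * r * (2 - 3 * r) by rewrite mulr_gt0 ?r0_lt// mulr_gt0 ?r0_gt0.
rewrite /C0; have /andP[l u] := r0_bounds.
rewrite ltr_distl ltr_pdivrMr// ltr_pdivlMr//; apply/andP; split; nra.
Qed.

End Constants.

(** * Expansion of the middle coefficient *)

Section ZetaExpansion.
Variable R : realType.
Implicit Types a : R.

Definition theta a : R := pi / 3 + alpha1 R * a + alpha2 R * a ^+ 2.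

(** The [m] of [shifted_cubic]: the quadratic with roots [zeta a] and its conjugate is
    [z^2 - (1 - m) z + 1]. *)
Definition mid a : R := 1 - 2 * cos (theta a).

Lemma mid_expansion : exists M, forall a, 0 < a <= 1 ->
  exists2 rho, `|rho| <= M & mid a = mid_coef (mu1 R) (mu2 R) a rho.
Proof.
pose D a := 0 <= a <= 1.
pose h a := alpha1 R + alpha2 R * a.
have ba : bounded_on D id.
  by apply: (@bounded_on_le _ _ _ _ 1) => a /andP[? ?]; rewrite ger0_norm.
have bh : bounded_on D h by rewrite /h; bounded.
pose q : R := Num.sqrt 3.
have [M M0 MP] : bounded_on D (fun a => `|alpha1 R * alpha2 R + alpha2 R ^+ 2 * a / 2|
    + q * `|h a| ^+ 3 + `|h a| ^+ 4).
  have bn f : bounded_on D f -> bounded_on D (fun a => `|f a|).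
    by move=> [N N0 fN]; exists N => // t /fN; rewrite normr_id.
  by bounded; apply: bn; bounded.
exists M => a /andP[a_gt0 a_le].
pose d := a * h a.
have a3 : a ^+ 3 != 0 by rewrite gt_eqF// exprn_gt0.
exists ((mid a - mu1 R * a - mu2 R * a ^+ 2) / a ^+ 3); last first.
  by rewrite /mid_coef; field; rewrite ?gt_eqF.
have thE : theta a = pi / 3 + d by rewrite /theta /d /h; ring.
(* The first summand is the part of [d^2 / 2] of order at least three in [a]; the others are Taylor
   remainders in [d = a h(a)]. *)
have -> : mid a - mu1 R * a - mu2 R * a ^+ 2 =
   (alpha1 R * alpha2 R + alpha2 R ^+ 2 * a / 2) * a ^+ 3
   + q * (sin d - d) - (cos d - 1 + d ^+ 2 / 2).
  rewrite /mid thE cosD cos_pi3 sin_pi3 /mu1 /mu2 -/q.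
  have -> : 1 - 2 * (1 / 2 * cos d - q / 2 * sin d) = 1 - cos d + q * sin d by field.
  by move: (cos d) (sin d) => cd sd; rewrite /d /h; field.
have D_a : D a by rewrite /D ltW.
apply: le_trans (le_trans (ler_norm _) (MP _ D_a)).
rewrite normrM normfV ler_pdivrMr ?normr_gt0//.
have a3E : `|a ^+ 3| = a ^+ 3 by rewrite ger0_norm// exprn_ge0// ltW.
have dE n : `|d| ^+ n = a ^+ n * `|h a| ^+ n.
  by rewrite normrM exprMn gtr0_norm.
rewrite a3E [leRHS]mulrDl (le_trans (ler_normB _ _))// lerD//.
  rewrite [leRHS]mulrDl (le_trans (ler_normD _ _))// lerD//; first by rewrite normrM a3E.
  rewrite normrM (ger0_norm (sqrtr_ge0 _)) -mulrA ler_wpM2l ?sqrtr_ge0//.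
  by rewrite (le_trans (sin_taylor _))// dE mulrC.
rewrite (le_trans (cos_taylor _))// dE mulrC ler_wpM2l ?exprn_ge0//.
by rewrite exprS ler_piMl// exprn_ge0 ?ltW.
Qed.

End ZetaExpansion.

(** * Moduli, and bounds for [crit_dist] and [sendov_d] *)

Section CriticalDistance.
Variable R : realType.
Implicit Types (p : {poly R[i]}) (z w : R[i]).

Lemma cabsE (x y : R) : cabs (x +i* y)%C = Num.sqrt (x ^+ 2 + y ^+ 2).
Proof. by []. Qed.

Lemma cabs_ge0 z : 0 <= cabs z.
Proof. by case: z => x y; exact: sqrtr_ge0. Qed.

Lemma cabs_real (x : R) : cabs (x%:C)%C = `|x|.
Proof. by rewrite cabsE expr0n addr0 sqrtr_sqr. Qed.

Lemma cabs_le (x y c : R) : 0 <= c ->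
  (cabs (x +i* y)%C <= c) = (x ^+ 2 + y ^+ 2 <= c ^+ 2).
Proof.
move=> c0; rewrite cabsE -{1}(ger0_norm c0) -sqrtr_sqr ler_sqrt//.
exact: sqr_ge0.
Qed.

Lemma crit_dist_le p z w : root p^`() w -> crit_dist p z <= cabs (z - w).
Proof.
move=> pw; apply: ge_inf; last by exists w.
by exists 0 => _ [? _ <-]; exact: cabs_ge0.
Qed.

(** The witness [w0] rules out the infimum of the empty set, a mere default value. *)
Lemma crit_dist_ge p z w0 (c : R) : root p^`() w0 ->
  (forall w, root p^`() w -> c <= cabs (z - w)) -> c <= crit_dist p z.
Proof.
move=> pw0 cw; apply: lb_le_inf; first by exists (cabs (z - w0)); exists w0.
by move=> _ [w pw <-]; exact: cw.
Qed.

Lemma sendov_d_le p z0 (c : R) : root p z0 ->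
  (forall z, root p z -> crit_dist p z <= c) -> sendov_d p <= c.
Proof.
move=> pz0 pc; apply: ge_sup; first by exists (crit_dist p z0); exists z0.
by move=> _ [z pz <-]; exact: pc.
Qed.

Lemma sendov_d_max p z : root p z ->
  (forall w, root p w -> crit_dist p w <= crit_dist p z) ->
  sendov_d p = crit_dist p z.
Proof.
move=> pz zmax; apply/eqP; rewrite eq_le (sendov_d_le pz zmax)/=.
apply: ub_le_sup; last by exists z.
by exists (crit_dist p z) => _ [w pw <-]; exact: zmax.
Qed.

End CriticalDistance.

(** * Bounding the matching distance by a convenient ordering of the zeros *)

Section Matching.
Variable R : realType.

Lemma perm_eq_nth_perm (T : eqType) (x0 : T) n (s t : seq T) :
  perm_eq s t -> size t = n ->
  exists p : 'S_n, forall i : 'I_n, nth x0 s i = nth x0 t (p i).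
Proof.
move=> st /eqP tn; have /tuple_permP[p ->] : perm_eq s (Tuple tn) by [].
by exists p => i; rewrite -tnth_nth tnth_mktuple (tnth_nth x0).
Qed.

Lemma root_seq_prod (s : seq R[i]) :
  perm_eq (root_seq (\prod_(z <- s) ('X - z%:P))) s.
Proof.
rewrite /root_seq; case: closed_field_poly_normal => t /=.
rewrite (monicP (monic_prod_XsubC _ _ _)) scale1r => /esym tE.
by apply: prod_XsubC_eq.
Qed.

Lemma matching_dist_ge0 n (s t : seq R[i]) : 0 <= matching_dist n s t.
Proof.
by apply/bigmin_geP; split=> [|? _]; exact: bigmax_ge_id.
Qed.

Lemma matching_dist_le n (s t s' t' : seq R[i]) (c : R) :
  perm_eq s s' -> perm_eq t t' -> size s' = n -> size t' = n -> 0 <= c ->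
  (forall i : 'I_n, cabs (s'`_i - t'`_i) <= c) -> matching_dist n s t <= c.
Proof.
move=> ss' tt' /(perm_eq_nth_perm 0 ss')[p sp] /(perm_eq_nth_perm 0 tt')[q tq].
(* Passing from [s] to [s'] by [p] and back from [t'] to [t] by the inverse of [q] pairs equal
   positions of [s'] and [t']. *)
move=> c0 st; apply: le_trans (bigmin_le _ (p * q^-1)%g _) _.
by apply: bigmax_le => // i _; rewrite sp tq permM permKV st.
Qed.

End Matching.

(** * The polynomials [p_ a] and their critical points *)

Lemma horner_deriv_prod4 (K : comNzRingType) (a b c d z : K) :
  (('X - a%:P) * ('X - b%:P) * ('X - c%:P) * ('X - d%:P))^`().[z] =
  (z - b) * (z - c) * (z - d) + (z - a) * (z - c) * (z - d)
  + (z - a) * (z - b) * (z - d) + (z - a) * (z - b) * (z - c).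
Proof. by rewrite !derivM !derivXsubC !hornerE /=; ring. Qed.

Section Polynomials.
Variable R : realType.
Implicit Types a : R.

Notation cos_ a := (cos (theta a)).
Notation sin_ a := (sin (theta a)).

Lemma zetaE a : zeta a = (cos_ a +i* sin_ a)%C. Proof. by []. Qed.

Definition p_roots a : seq R[i] := [:: (a%:C)%C; -1; zeta a; ((zeta a)^*)%C].

Lemma p_prod a : p_ a = \prod_(z <- p_roots a) ('X - z%:P).
Proof.
by rewrite /p_roots !big_cons big_nil mulr1 polyCN opprK !mulrA.
Qed.

Lemma root_p_ a z : root (p_ a) z = (z \in p_roots a).
Proof. by rewrite p_prod root_prod_XsubC. Qed.

Lemma unit_disk_p_ a : 0 <= a <= 1 -> unit_disk_polys 4 (p_ a).
Proof.
move=> /andP[a0 a1]; split.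
- by rewrite p_prod monic_prod_XsubC.
- by rewrite p_prod size_prod_XsubC.
move=> z; rewrite /zeros/= root_p_ !inE => /or4P[] /eqP ->.
- by rewrite cabs_real ger0_norm.
- have -> : -1 = ((- 1)%:C)%C :> R[i] by rewrite rmorphN1.
  by rewrite cabs_real normrN1.
- by rewrite zetaE cabs_le// cos2Dsin2 expr1n.
- by rewrite zetaE cabs_le// sqrrN cos2Dsin2 expr1n.
Qed.

Lemma theta0 : theta (0 : R) = pi / 3.
Proof. by rewrite /theta expr0n !mulr0 !addr0. Qed.

Lemma mid0 : mid (0 : R) = 0.
Proof. by rewrite /mid theta0 cos_pi3; field. Qed.

Lemma zetaD a : zeta a + ((zeta a)^*)%C = ((1 - mid a)%:C)%C.
Proof.
by apply/eqP; rewrite zetaE eq_complex/= /mid; apply/andP; split; apply/eqP; ring.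
Qed.

Lemma zetaM a : zeta a * ((zeta a)^*)%C = 1.
Proof.
have cs := cos2Dsin2 (theta a); apply/eqP; rewrite zetaE eq_complex/=.
by apply/andP; split; apply/eqP; [rewrite -[RHS]cs|]; ring.
Qed.

Lemma p_0 : p_ 0 = 'X^4 + 'X :> {poly R[i]}.
Proof.
have := zetaD 0; have := zetaM 0; rewrite mid0 subr0 /p_.
move: (zeta 0) ((zeta 0)^*)%C => w w' wM wD.
rewrite polyC0 subr0 -mulrA.
have -> : ('X - w%:P) * ('X - w'%:P) = 'X^2 - (w + w')%:P * 'X + (w * w')%:P.
  by rewrite polyCD polyCM; ring.
by rewrite wM wD polyC1; ring.
Qed.

(** [shifted_cubic] with [m = mid a] at a complex argument, which transfers the real factorization
    to all critical points. *)
Lemma deriv_p_ a (v : R[i]) : (p_ a)^`().[(a%:C)%C + v] =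
  4 * v ^+ 3 + ((3 * (3 * a + mid a))%:C)%C * v ^+ 2
  + ((2 * (3 * a ^+ 2 + 2 * a * mid a + mid a))%:C)%C * v
  + ((a ^+ 3 + mid a * a ^+ 2 + mid a * a + 1)%:C)%C.
Proof.
have := zetaD a; have := zetaM a; rewrite /p_.
move: (zeta a) ((zeta a)^*)%C => w w' wM wD.
have -> : 'X + 1 = 'X - (- 1)%:P :> {poly R[i]} by rewrite polyCN opprK.
rewrite horner_deriv_prod4; move: (mid a) wM wD => m wM wD.
set z := _ + v; set A := (a%:C)%C.
(* Grouping the conjugate factors leaves only [w + w'] and [w * w']. *)
transitivity ((2 * z + 1 - A) * (z ^+ 2 - (w + w') * z + w * w')
  + (z - A) * (z + 1) * (2 * z - (w + w'))); first by ring.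
by rewrite wM wD /z /A; ring.
Qed.

Section CriticalPoints.
Variables (a v1 b e : R).
Hypotheses (coef2 : 3 * (3 * a + mid a) = b - 4 * v1)
  (coef1 : 2 * (3 * a ^+ 2 + 2 * a * mid a + mid a) = e - v1 * b)
  (coef0 : a ^+ 3 + mid a * a ^+ 2 + mid a * a + 1 = - v1 * e).
Hypothesis disc : b ^+ 2 <= 16 * e.

Let x := - b / 8.
Let y := Num.sqrt (e / 4 - x ^+ 2).

(** By [disc], [y] satisfies [x^2 + y^2 = e / 4], so [x + i y] and [x - i y] are the roots of the
    quadratic factor [v^2 + (b / 4) v + e / 4]. *)
Lemma root_deriv_p_ w : root (p_ a)^`() w =
  (w \in [:: ((a + v1)%:C)%C; ((a + x) +i* y)%C; ((a + x) -i* y)%C]).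
Proof.
have y2 : y ^+ 2 = e / 4 - x ^+ 2.
  by rewrite sqr_sqrtr// /x; move: disc => disc'; lra.
have -> : w = (a%:C)%C + (w - (a%:C)%C) by rewrite addrC subrK.
move: (w - _) => {}w; rewrite /root deriv_p_ coef2 coef1 coef0.
pose v2 : R[i] := (x +i* y)%C; pose v3 : R[i] := (x -i* y)%C.
have vD : ((b / 4)%:C)%C = - (v2 + v3).
  by apply/eqP; rewrite eq_complex/= /x; apply/andP; split; apply/eqP; field.
have vM : ((e / 4)%:C)%C = v2 * v3.
  apply/eqP; rewrite eq_complex/=; apply/andP; split; apply/eqP; last by ring.
  by rewrite mulrN opprK -!expr2 y2; ring.
have -> : 4 * w ^+ 3 + ((b - 4 * v1)%:C)%C * w ^+ 2 + ((e - v1 * b)%:C)%C * w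
    + ((- v1 * e)%:C)%C = 4 * (w - (v1%:C)%C) * (w - v2) * (w - v3).
  transitivity (4 * (w - (v1%:C)%C)
      * (w ^+ 2 + ((b / 4)%:C)%C * w + ((e / 4)%:C)%C)); last first.
    by rewrite vD vM; ring.
  rewrite [in LHS](_ : b = 4 * (b / 4)); last by field.
  rewrite [in LHS](_ : e = 4 * (e / 4)); last by field.
  by ring.
rewrite !mulf_eq0 pnatr_eq0/= !subr_eq0 !inE orbA.
have E1 : ((a + v1)%:C)%C = (a%:C)%C + (v1%:C)%C by rewrite rmorphD.
have E2 : ((a + x) +i* y)%C = (a%:C)%C + v2.
  by apply/eqP; rewrite eq_complex/= add0r !eqxx.
have E3 : ((a + x) -i* y)%C = (a%:C)%C + v3.
  by apply/eqP; rewrite eq_complex/= add0r !eqxx.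
by rewrite E1 E2 E3 !(inj_eq (addrI _)).
Qed.

End CriticalPoints.

End Polynomials.

(** * Locating zeros and critical points for small [a] *)

Section CriticalPointsNearLimit.
Variable R : realType.
Implicit Types a b e s : R.

Notation r := (r0 R).

(** Coefficientwise form of the factorization [4 (v - v1) (v^2 + (b / 4) v + e / 4)]. *)
Definition cubic_split a (v1 : R) b e : Prop :=
  [/\ 3 * (3 * a + mid a) = b - 4 * v1,
      2 * (3 * a ^+ 2 + 2 * a * mid a + mid a) = e - v1 * b &
      a ^+ 3 + mid a * a ^+ 2 + mid a * a + 1 = - v1 * e].

(** Each 1/500 adds two tolerances of 1/1000 from [shifted_cubic_factor]: root to [main_modulus],
    and [main_modulus] to [r]. *)
Definition near_limit a (v1 : R) e : Prop :=
  [/\ 0 <= a <= 1 / 1000, `|mid a| <= 1 / 1000, `|v1 + r| <= 1 / 500, 0 <= e &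
      `|Num.sqrt (e / 4) - r| <= 1 / 500].

(** The intervals surround the values at [a = 0], namely [r / 2], [r^2], [- r] and 1/2. *)
Lemma near_limit_bounds a (v1 : R) b e : cubic_split a v1 b e -> near_limit a v1 e ->
  [/\ 309 / 1000 <= - b / 8 <= 323 / 1000, 39 / 100 <= e / 4 <= 41 / 100,
      - 64 / 100 <= v1 <= - 62 / 100 & 4995 / 10 ^+ 4 <= (1 - mid a) / 2 <= 5005 / 10 ^+ 4].
Proof.
move=> [c2 _ _] [/andP[a0 a1] m_small v_near e0 e_near].
have : 629 / 1000 <= r <= 630 / 1000.
  have := r0_bounds R; move: r => x; clear=> /andP[l u].
  by apply/andP; split; lra.
have : e / 4 = Num.sqrt (e / 4) ^+ 2 by rewrite sqr_sqrtr// divr_ge0.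
move: m_small v_near e_near c2; rewrite !ler_norml.
move: (Num.sqrt _) (mid a) r => w m x.
move=> /andP[m1 m2] /andP[v1l v1u] /andP[wl wu] c2 -> /andP[xl xu].
split; apply/andP; split.
- by clear -a1 m2 v1l v1u xl xu c2; lra.
- by clear -a0 m1 v1l v1u xl xu c2; lra.
- by clear -wl xl; nra.
- by clear -wl wu xl xu; nra.
- by clear -v1l xu; lra.
- by clear -v1u xl; lra.
- by clear -m2; lra.
- by clear -m1; lra.
Qed.

Lemma near_limit_disc a (v1 : R) b e : cubic_split a v1 b e -> near_limit a v1 e ->
  b ^+ 2 <= 16 * e.
Proof.
move=> sp nl; have [/andP[b1 b2] /andP[e1 e2] _ _] := near_limit_bounds sp nl.
by clear sp nl; nra.
Qed.

(** At [a = 0] the zero and a critical point lie on one ray, at moduli 1 and [r]; their distance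
    [1 - r], about 0.37, leaves ample room below [3 / 5 < r]. *)
Lemma crit_dist_unit_circle a (v1 : R) b e s :
  cubic_split a v1 b e -> near_limit a v1 e ->
  ((1 - mid a) / 2) ^+ 2 + s ^+ 2 = 1 ->
  crit_dist (p_ a) (((1 - mid a) / 2) +i* s)%C <= 3 / 5.
Proof.
move=> sp nl; have := root_deriv_p_ _ _ _ (near_limit_disc sp nl).
have [c2 c1 c0] := sp => /(_ _ _ c2 c1 c0) rootE.
have [bb /andP[e1 e2] _] := near_limit_bounds sp nl.
have [/andP[a0 a1] _ _ _ _] := nl.
move: bb rootE; set x := - b / 8; set y := Num.sqrt _ => /andP[x1 x2] rootE.
have y2 : y ^+ 2 = e / 4 - x ^+ 2.
  by rewrite sqr_sqrtr//; clear -x1 x2 e1; nra.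
have y0 : 0 <= y by exact: sqrtr_ge0.
move: ((1 - mid a) / 2) => c /andP[l u] cs.
have y_bd : 1 / 2 <= y <= 7 / 10.
  by clear -x1 x2 e1 e2 y2 y0; apply/andP; split; nra.
have close t : 0 <= t -> c ^+ 2 + t ^+ 2 = 1 ->
    (c - (a + x)) ^+ 2 + (t - y) ^+ 2 <= (3 / 5) ^+ 2.
  move: y_bd => /andP[y1 y3]; clear -a0 a1 x1 x2 y1 y3 l u => t0 ct.
  have t1 : 8 / 10 <= t by clear -t0 ct l u; nra.
  have t2 : t <= 1 by clear -t0 ct l u; nra.
  have d1 : (c - (a + x)) ^+ 2 <= (1 / 5) ^+ 2 by clear -l u a0 a1 x1 x2; nra.
  have d2 : (t - y) ^+ 2 <= (1 / 2) ^+ 2 by clear -t1 t2 y1 y3; nra.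
  by clear -d1 d2; lra.
(* The sign of [s] selects the critical point in the same half-plane. *)
have [s0|s0] := leP 0 s.
- apply: le_trans (crit_dist_le (w := ((a + x) +i* y)%C) _ _) _.
    by rewrite rootE !inE eqxx orbT.
  rewrite -[_ - _]/((c - (a + x)) +i* (s - y))%C cabs_le ?divr_ge0//.
  exact: close.
- apply: le_trans (crit_dist_le (w := ((a + x) -i* y)%C) _ _) _.
    by rewrite rootE !inE eqxx !orbT.
  rewrite -[_ - _]/((c - (a + x)) +i* (s - - y))%C cabs_le ?divr_ge0//.
  rewrite (_ : (s - - y) ^+ 2 = (- s - y) ^+ 2); last by ring.
  by apply: close; rewrite ?sqrrN// oppr_ge0 ltW.
Qed.

Lemma crit_dist_far a (v1 : R) b e z : cubic_split a v1 b e -> near_limit a v1 e ->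
  root (p_ a) z -> z != (a%:C)%C -> crit_dist (p_ a) z <= 3 / 5.
Proof.
move=> sp nl; rewrite root_p_ !inE => /or4P[] /eqP -> //; first by rewrite eqxx.
- move=> _; have [c2 c1 c0] := sp.
  have [/andP[a0 a1] _ _ _ _] := nl; have [_ _ /andP[v1l v1u] _] := near_limit_bounds sp nl.
  apply: le_trans (crit_dist_le (w := ((a + v1)%:C)%C) _ _) _.
    by rewrite (root_deriv_p_ c2 c1 c0 (near_limit_disc sp nl)) !inE eqxx.
  rewrite (_ : -1 - _ = ((- 1 - (a + v1))%:C)%C); last by rewrite !rmorphB rmorphN1.
  by rewrite cabs_real ler_norml; clear -a0 a1 v1l v1u; apply/andP; split; lra.
all: move=> _; have cE : cos (theta a) = (1 - mid a) / 2 by rewrite /mid; field.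
all: rewrite zetaE cE; apply: crit_dist_unit_circle sp nl _.
all: by rewrite -cE ?sqrrN cos2Dsin2.
Qed.

(** The distances from [a] to the critical points are [- v1] and, twice, [Num.sqrt (e / 4)]; all lie
    within [eps] of [S], hence so does their minimum. *)
Lemma crit_dist_center a (v1 : R) b e (S eps : R) :
  cubic_split a v1 b e -> near_limit a v1 e ->
  `|v1 + S| <= eps -> `|Num.sqrt (e / 4) - S| <= eps ->
  `|crit_dist (p_ a) (a%:C)%C - S| <= eps.
Proof.
move=> sp nl v1S eS; have [c2 c1 c0] := sp.
have rootE := root_deriv_p_ c2 c1 c0 (near_limit_disc sp nl).
have [bb /andP[e1 e2] /andP[_ v1u] _] := near_limit_bounds sp nl.
have v1_lt0 : v1 < 0 by clear -v1u; lra.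
have cabs1 : cabs ((a%:C)%C - ((a + v1)%:C)%C) = - v1.
  by rewrite -rmorphB cabs_real opprD addNKr normrN ltr0_norm.
have sqE : (- b / 8) ^+ 2 + Num.sqrt (e / 4 - (- b / 8) ^+ 2) ^+ 2 = e / 4.
  rewrite sqr_sqrtr; first by rewrite addrC subrK.
  by have := near_limit_disc sp nl; clear; lra.
move: rootE sqE; set x := - b / 8; set y := Num.sqrt _ => rootE sqE.
have cabs2 : cabs ((a%:C)%C - ((a + x) +i* y)%C) = Num.sqrt (e / 4).
  rewrite -[_ - _]/((a - (a + x)) +i* (0 - y))%C cabsE opprD addNKr sub0r.
  by rewrite !sqrrN sqE.
have cabs3 : cabs ((a%:C)%C - ((a + x) -i* y)%C) = Num.sqrt (e / 4).
  rewrite -[_ - _]/((a - (a + x)) +i* (0 - - y))%C cabsE opprD addNKr sub0r.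
  by rewrite !sqrrN sqE.
have root1 : root (p_ a)^`() ((a + v1)%:C)%C by rewrite rootE !inE eqxx.
move: v1S eS; rewrite !ler_norml => /andP[l1 u1] /andP[l2 u2].
rewrite lerBlDr lerBrDr; apply/andP; split.
  apply: (crit_dist_ge root1) => w; rewrite rootE !inE.
  case/or3P => /eqP ->; rewrite ?cabs1 ?cabs2 ?cabs3.
  - by clear -u1; lra.
  - by clear -l2; lra.
  - by clear -l2; lra.
by rewrite (le_trans (crit_dist_le _ root1))// cabs1; clear -l1; lra.
Qed.

Lemma sendov_d_center a (v1 : R) b e (S eps : R) :
  cubic_split a v1 b e -> near_limit a v1 e ->
  `|v1 + S| <= eps -> `|Num.sqrt (e / 4) - S| <= eps -> 3 / 5 <= S - eps ->
  sendov_d (p_ a) = crit_dist (p_ a) (a%:C)%C.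
Proof.
move=> sp nl v1S eS S_ge; apply: sendov_d_max.
  by rewrite root_p_ inE eqxx.
move=> w pw; have [->//|wa] := eqVneq w (a%:C)%C.
apply: le_trans (crit_dist_far sp nl pw wa) _.
have := crit_dist_center sp nl v1S eS; rewrite ler_norml => /andP[l _].
by clear -S_ge l; lra.
Qed.

Lemma sendov_d_family : exists K a0, [/\ 0 <= K, 0 < a0 <= 1 &
  forall a, 0 < a <= a0 ->
    sendov_d (p_ a) = crit_dist (p_ a) (a%:C)%C /\
    `|crit_dist (p_ a) (a%:C)%C - (r + C0 R * a ^+ 2)| <= K * a ^+ 3].
Proof.
have [M MP] := mid_expansion R.
have [K [a0 [K0 /andP[a00 a01] aP]]] :=
  shifted_cubic_factor M (second_order_system_r0 R).
exists K, a0; split=> //; first by rewrite a00.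
move=> a /[dup] a_bd /andP[a_gt0 a_le].
have [rho rhoM mE] : exists2 rho, `|rho| <= M
    & mid a = mid_coef (mu1 R) (mu2 R) a rho.
  by apply: MP; rewrite a_gt0 (le_trans a_le).
have [v1 [b [e [split_a v1S eS [a_small m_small S_small K_small e0]]]]] :=
  aP a rho a_bd rhoM.
rewrite -mE in split_a m_small.
have nl : near_limit a v1 e.
  move: v1S eS S_small; set S := main_modulus _ _ _.
  move: K_small => K_small v1S' eS' S_small'.
  split=> //; first by rewrite (ltW a_gt0).
    move: K_small v1S' S_small'; rewrite !ler_norml; clear.
    by move=> ? /andP[? ?] /andP[? ?]; apply/andP; split; lra.
  move: K_small eS' S_small'; rewrite !ler_norml; clear.
  by move=> ? /andP[? ?] /andP[? ?]; apply/andP; split; lra.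
split; last exact: crit_dist_center split_a nl v1S eS.
apply: (sendov_d_center split_a nl v1S eS).
have /andP[r_ge _] := r0_rough R.
move: S_small; rewrite ler_norml => /andP[S_small _].
by clear -S_small r_ge K_small; lra.
Qed.

(** Here [4 v^3 + 1 = 4 (v + r) (v^2 - r v + r^2)] exactly, so the previous lemmas apply with
    [eps = 0]. *)
Lemma sendov_d_p_0 : sendov_d (p_ (0 : R)) = r.
Proof.
have r3 := r0_cube R; have r_gt0 := r0_gt0 R.
have e4 : 4 * r ^+ 2 / 4 = r ^+ 2 by field.
have sp : cubic_split 0 (- r) (- 4 * r) (4 * r ^+ 2).
  rewrite /cubic_split mid0; split; [ring|ring|].
  by transitivity (4 * r ^+ 3); [rewrite r3; ring|ring].
have nl : near_limit 0 (- r) (4 * r ^+ 2).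
  have h1 : 0 <= 1 / 1000 :> R by lra.
  have h5 : 0 <= 1 / 500 :> R by lra.
  rewrite /near_limit mid0 e4 sqrtr_sqr (gtr0_norm r_gt0) addNr subrr normr0 lexx.
  by split=> //; rewrite mulr_ge0// sqr_ge0.
have v1S : `|- r + r| <= 0 by rewrite addNr normr0.
have eS : `|Num.sqrt (4 * r ^+ 2 / 4) - r| <= 0.
  by rewrite e4 sqrtr_sqr (gtr0_norm r_gt0) subrr normr0.
rewrite (sendov_d_center sp nl v1S eS); last first.
  by have /andP[r_ge _] := r0_rough R; clear -r_ge; lra.
have := crit_dist_center sp nl v1S eS.
by rewrite normr_le0 subr_eq0 => /eqP.
Qed.

Lemma Delta_family : exists2 K, 0 <= K & forall a, 0 < a <= 1 ->
  0 <= Delta (p_ a) ('X^4 + 'X) <= K * a.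
Proof.
pose B := `|alpha1 R| + `|alpha2 R|.
(* [B] bounds the rate of change of [theta], hence of both coordinates of [zeta]; [2 B] exceeds the
   resulting factor [sqrt 2 B], and the 1 covers the zero [a] moving from 0. *)
exists (2 * B + 1); first by rewrite addr_ge0// mulr_ge0// addr_ge0.
move=> a /andP[a_gt0 a_le]; rewrite /Delta.
have a01 : 0 <= a <= 1 by rewrite (ltW a_gt0).
have [_ -> _] := unit_disk_p_ a01.
rewrite matching_dist_ge0/= -p_0 !p_prod.
have B0 : 0 <= B by rewrite addr_ge0.
have th : `|theta a - theta 0| <= B * a.
  rewrite theta0 /theta (_ : _ - _ = (alpha1 R + alpha2 R * a) * a); last by ring.
  rewrite normrM (gtr0_norm a_gt0) ler_wpM2r ?(ltW a_gt0)//.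
  rewrite (le_trans (ler_normD _ _))// lerD2l normrM (gtr0_norm a_gt0).
  by rewrite ler_piMr.
have Ba : 0 <= B * a by rewrite mulr_ge0// ltW.
have K0 : 0 <= (2 * B + 1) * a.
  by rewrite mulr_ge0 ?(ltW a_gt0)// addr_ge0// mulr_ge0.
have small_sqrt x y : `|x| <= B * a -> `|y| <= B * a ->
    Num.sqrt (x ^+ 2 + y ^+ 2) <= (2 * B + 1) * a.
  have sq_le z : `|z| <= B * a -> z ^+ 2 <= (B * a) ^+ 2.
    by move=> h; rewrite -real_normK ?num_real// ler_pXn2r ?nnegrE.
  move=> /sq_le + /sq_le; rewrite -cabsE cabs_le//.
  have -> : (2 * B + 1) * a = 2 * (B * a) + a by ring.
  move: (B * a) Ba => t t0; clear -t0 a_gt0 => x2 y2.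
  have : 0 <= t * a by rewrite mulr_ge0// ltW.
  rewrite (_ : (2 * t + a) ^+ 2 = 4 * t ^+ 2 + 4 * (t * a) + a ^+ 2); last by ring.
  by have := sqr_ge0 a; have := sqr_ge0 t; lra.
have cos_near := le_trans (cos_lipschitz (theta a) (theta 0)) th.
have sin_near := le_trans (sin_lipschitz (theta a) (theta 0)) th.
apply: (matching_dist_le (root_seq_prod _) (root_seq_prod _)) => // -[[|[|[|[|//]]]] ?] /=.
- rewrite !subr0 expr0n addr0 sqrtr_sqr gtr0_norm// ler_peMl ?(ltW a_gt0)//.
  by rewrite lerDr mulr_ge0.
- by rewrite !subrr expr0n addr0 sqrtr0.
- exact: small_sqrt.
- by apply: small_sqrt => //; rewrite -opprD normrN.
Qed.

End CriticalPointsNearLimit.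

(** * Asymptotics of the family and failure of local maximality *)

Theorem theorem2p3 (R : realType) :
  (forall a : R, 0 <= a <= 1 -> unit_disk_polys 4 (p_ a)) /\
  (fun a : R => Delta (p_ a) ('X^4 + 'X)) =O_ (0^'+) (fun a : R => a) /\
  (\forall a \near (0 : R)^'+, sendov_d (p_ a) = crit_dist (p_ a) (a%:C)%C) /\
  (fun a : R => sendov_d (p_ a))
    = (fun a : R => r0 R + C0 R * a ^+ 2) +O_ (0^'+) (fun a : R => a ^+ 3) /\
  `|C0 R - (10 + 811 / 10 ^+ 3 + 549 / 10 ^+ 6 + 38 / 10 ^+ 8)| < 1 / 10 ^+ 7 /\
  unit_disk_polys 4 ('X^4 + 'X : {poly R[i]}) /\
  ~ locally_maximal 4 ('X^4 + 'X : {poly R[i]}).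
Proof.
have [K [a0 [K0 /andP[a0_gt0 a0_le] dP]]] := sendov_d_family R.
have [L L0 DP] := Delta_family R.
have near_small c : 0 < c -> \forall a \near (0 : R)^'+, 0 < a <= c.
  move=> c0; near=> a; apply/andP; split; near: a; first exact: nbhs_right_gt.
  exact: nbhs_right_ltW.
split; first exact: unit_disk_p_.
split.
  apply/eqO_exP; exists (L + 1); first by rewrite ltr_wpDl.
  near=> a; have /andP[a_gt0 a_le1] : 0 < a <= 1 by near: a; exact: near_small.
  have /andP[D0 DL] : 0 <= Delta (p_ a) ('X^4 + 'X) <= L * a.
    by apply: DP; rewrite a_gt0.
  rewrite ger0_norm// gtr0_norm// (le_trans DL)// ler_wpM2r ?(ltW a_gt0)//.
  by rewrite lerDl.
split.
  near=> a; have /dP[] // : 0 < a <= a0 by near: a; exact: near_small.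
split.
  apply/eqaddOP/bigO_exP; exists (K + 1); first by rewrite ltr_wpDl.
  near=> a; have a_le : 0 < a <= a0 by near: a; exact: near_small.
  have [[dE dK] /andP[a_gt0 _]] := (dP a a_le, a_le).
  have a3 : 0 <= a ^+ 3 by rewrite exprn_ge0// ltW.
  rewrite -[leLHS]/(`|sendov_d (p_ a) - (r0 R + C0 R * a ^+ 2)|) dE.
  rewrite (ger0_norm a3) (le_trans dK)// ler_wpM2r// lerDl//.
split; first exact: C0_approx.
split; first by rewrite -p_0; apply: unit_disk_p_; rewrite lexx ler01.
move=> [eps eps0 maxP].
have C_gt0 := C0_gt0 R.
near (0 : R)^'+ => a.
have a_le1 : 0 < a <= 1 by near: a; exact: near_small.
have a_le : 0 < a <= a0 by near: a; exact: near_small.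
(* This bound makes [L a < eps], so [p_ a] is a competitor; the next makes [K a^3 < C a^2], so the
   gain survives the error. *)
have aL : 0 < a <= eps / (L + 1).
  by near: a; apply: near_small; rewrite divr_gt0// ltr_wpDl.
have aK : 0 < a <= C0 R / (K + 1).
  by near: a; apply: near_small; rewrite divr_gt0// ltr_wpDl.
have [dE dK] := dP a a_le; have /andP[_ DL] := DP a a_le1.
move: aL aK a_le1 => /andP[a_gt0 aL] /andP[_ aK] /andP[_ a_le1].
have := maxP (p_ a); rewrite -{2}p_0 sendov_d_p_0 dE.
move=> /(_ (unit_disk_p_ _) _); rewrite (ltW a_gt0) => /(_ a_le1).
have -> : Delta (p_ a) ('X^4 + 'X) < eps.
  rewrite (le_lt_trans DL)//; move: aL; rewrite ler_pdivlMr ?ltr_wpDl//.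
  by apply: lt_le_trans; rewrite mulrC ltr_pM2l// ltrDl.
move=> /(_ isT); apply/negP; rewrite -ltNge.
have a2 : 0 < a ^+ 2 by rewrite exprn_gt0.
have Ka : K * a ^+ 3 < C0 R * a ^+ 2.
  rewrite exprS mulrA ltr_pM2r//; move: aK; rewrite ler_pdivlMr ?ltr_wpDl//.
  by apply: lt_le_trans; rewrite mulrC ltr_pM2l// ltrDl.
move: dK; rewrite ler_norml => /andP[dK _].
by clear -dK Ka; lra.
Unshelve. all: by end_near. Qed.
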